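(* Let $(u^s,\phi^s,p^s)\in V_h\times Q_h\times Q_h$, $s=0,1,2,\dots$, be generated from an arbitrary $p^0\in Q_h$ by $$1.5(u^s,w_i)+k\nu(\nabla u^s,\nabla w_i)-k(\nabla\cdot w_i,p^s)=(F,w_i),\quad i=1,\dots,l,$$ $$(\nabla\phi^s,\nabla q_i)=-\tfrac1k(\nabla\cdot u^s,q_i),\quad i=1,\dots,m,$$ $$(p^{s+1},q_i)=(p^s,q_i)+\alpha(\phi^s,q_i)-\rho(\nabla\cdot u^s,q_i),\quad i=1,\dots,m,$$ and let $(u,p)\in V_h\times Q_h$ be the solution of $$1.5(u,w_i)+k\nu(\nabla u,\nabla w_i)-k(\nabla\cdot w_i,p)=(F,w_i),\ i=1,\dots,l,\qquad (\nabla\cdot u,q_i)=0,\ i=1,\dots,m.$$ Let $\vec{\bar p}^{\,s}\in\mathbb{R}^m$ be the coefficient vector of $p^s-p$ in the basis $\{q_j\}$. Then for every $s\ge 0$ $$\|\vec{\bar p}^{\,s+1}\|_{K,\infty}\le \operatorname{spr}(I-K)\,\|\vec{\bar p}^{\,s}\|_{K,\infty}.$$ Furthermore, if $\max\left(\frac{\alpha}{1.5},\frac{\rho}{\nu}\right)<2$, then $(u^s,p^s)$ converges linearly to $(u,p)$ as $s\to\infty$.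
   Context: $\Omega\subset\mathbb{R}^3$ is a bounded domain (open, connected); $(\cdot,\cdot)$ is the $L^2(\Omega)$ inner product (for scalar, vector or matrix fields). $V=[H^1_0(\Omega)]^3$ and $Q=\{q\in L^2(\Omega):\int_\Omega q\,dx=0\}$. $V_h\subset V$ and $Q_h\subset Q\cap H^1(\Omega)$ are finite-dimensional spaces with bases $w_1,\dots,w_l$ of $V_h$ and $q_1,\dots,q_m$ of $Q_h$, satisfying the inf-sup condition $\inf_{0\ne q\in Q_h}\sup_{0\neq v\in V_h}\frac{(\nabla\cdot v,q)}{\|q\|_{L^2}\|\nabla v\|_{L^2}}>0$. $F\in [L^2(\Omega)]^3$ is given; $\nu>0$ (viscosity), $k>0$ (time step) and parameters $\alpha,\rho\ge0$, not both zero, are given. Matrices: $A_{ij}=1.5(w_i,w_j)+k\nu(\nabla w_i,\nabla w_j)$ ($l\times l$), $B_{ij}=-(q_i,\nabla\cdot w_j)$ ($m\times l$), $G_{ij}=(\nabla q_i,\nabla q_j)$, $M_{ij}=(q_i,q_j)$ ($m\times m$), and $K=(\alpha G^{-1}+\rho kM^{-1})BA^{-1}B^T$ ($m\times m$). $\operatorname{spr}(\cdot)$ denotes the spectral radius. $K$ has a basis of $\mathbb{R}^m$ consisting of eigenvectors; fix one, $\{\vec\xi_1,\dots,\vec\xi_m\}$, and for $\vec q=\sum_j q_{K,j}\vec\xi_j\in\mathbb{R}^m$ set $\|\vec q\|_{K,\infty}=\max_j|q_{K,j}|$. ''Converges linearly'' means that the errors $u^s-u$ and $p^s-p$ are bounded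 (in any norm on the finite-dimensional spaces) by $c\,\gamma^s$ for some constants $c\geq 0$ and $\gamma\in(0,1)$. *)

(* Defs.v *)
From HB Require Import structures.
From mathcomp Require Import all_boot all_order all_algebra.
From mathcomp Require Import all_classical all_reals all_analysis.
From mathcomp Require Import complex.

Set Implicit Arguments.
Unset Strict Implicit.
Unset Printing Implicit Defensive.

Import Order.TTheory GRing.Theory Num.Theory.
Import numFieldNormedType.Exports.

Local Open Scope classical_set_scope.
Local Open Scope ring_scope.

(* R^3, carrying both its normed space structure and the product sigma-algebra
   of the one on which [lebesgue_measure] is defined. *)
Definition R3 (R : realType) : Type :=
  (measurableTypeR R * measurableTypeR R * measurableTypeR R)%type.

Definition leb3 (R : realType) : {measure set (R3 R) -> \bar R} :=
  ((@lebesgue_measure R \x @lebesgue_measure R) \x @lebesgue_measure R)%E.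

Definition basis_vec (R : realType) (i : 'I_3) : R3 R :=
  ((i == 0 :> nat)%:R, (i == 1 :> nat)%:R, (i == 2 :> nat)%:R).

Definition bounded_domain (R : realType) (Omega : set (R3 R)) : Prop :=
  [/\ Omega !=set0, open Omega, connected Omega & bounded_set Omega].

Definition partial (R : realType) (i : 'I_3) (f : R3 R -> R) : R3 R -> R :=
  fun x => 'D_(basis_vec R i) f x.

Definition smooth (R : realType) (f : R3 R -> R) : Prop :=
  forall s : seq 'I_3, let g := foldr (@partial R) f s in
    continuous g /\ forall i x, derivable g x (basis_vec R i).

(* A weakly differentiable scalar field is a pair (value, weak gradient), i.e.
   an element of the graph of the weak gradient. The second component is
   determined by the first up to a null set; elements of Sobolev spaces are
   handled through representatives, and sums and scalings are componentwise. *)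
Notation wfield R := ((R3 R -> R) * ('I_3 -> R3 R -> R))%type.

(* A weakly differentiable vector field v, with [(v i).1] its i-th component
   and [(v i).2 j] the weak derivative of that component in direction j. *)
Notation wvfield R := ('I_3 -> wfield R).

Section fields.
Context (R : realType) (Omega : set (R3 R)).
Implicit Types (f g : R3 R -> R).

Definition L2 : set (R3 R -> R) :=
  [set f | f \_ Omega \in Lfun (leb3 R) 2%:E].

Definition ip f g : R := \int[leb3 R]_(x in Omega) (f x * g x).

Definition ip_vec (u v : 'I_3 -> R3 R -> R) : R := \sum_i ip (u i) (v i).

Definition ip_mat (A B : 'I_3 -> 'I_3 -> R3 R -> R) : R :=
  \sum_i \sum_j ip (A i j) (B i j).

Definition L2norm f : R := Num.sqrt (ip f f).

Definition L2norm_mat (A : 'I_3 -> 'I_3 -> R3 R -> R) : R :=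
  Num.sqrt (ip_mat A A).

Definition test_function : set (R3 R -> R) :=
  [set phi | smooth phi /\
    exists K : set (R3 R), [/\ compact K, K `<=` Omega &
      forall x, ~ K x -> phi x = 0]].

Definition weak_partial (i : 'I_3) f g : Prop :=
  forall phi, test_function phi -> ip f (partial i phi) = - ip g phi.

Definition H1 : set (wfield R) :=
  [set q | L2 q.1 /\
    forall i, L2 (q.2 i) /\ weak_partial i q.1 (q.2 i)].

(* Closure of the test functions in the H^1 norm. *)
Definition H10 : set (wfield R) :=
  [set v | H1 v /\
    exists phi : nat -> R3 R -> R, [/\ forall n, test_function (phi n),
      L2norm (phi n - v.1) @[n --> \oo] --> (0 : R) &
      forall i, L2norm (partial i (phi n) - v.2 i) @[n --> \oo] --> (0 : R)]].

Definition vel (v : wvfield R) : 'I_3 -> R3 R -> R := fun i => (v i).1.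

Definition jac (v : wvfield R) : 'I_3 -> 'I_3 -> R3 R -> R :=
  fun i j => (v i).2 j.

Definition div (v : wvfield R) : R3 R -> R := fun x => \sum_i jac v i i x.

Definition mean_zero (q : wfield R) : Prop :=
  \int[leb3 R]_(x in Omega) q.1 x = 0.

Definition null_field (q : wfield R) : Prop :=
  {ae leb3 R, forall x, Omega x -> q.1 x = 0}.

Definition null_vfield (v : wvfield R) : Prop := forall i, null_field (v i).

Definition lincomb (V : lmodType R) n (b : 'I_n -> V) (c : 'cV[R]_n) : V :=
  \sum_j c j 0 *: b j.

Definition lin_span (V : lmodType R) n (b : 'I_n -> V) : set V :=
  range (lincomb b).

(* Linear independence modulo fields that vanish almost everywhere; the span
   of [b] is then isomorphic to its image in the quotient by these fields. *)
Definition indep (V : lmodType R) (null : V -> Prop) n (b : 'I_n -> V) : Prop :=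
  forall c : 'cV[R]_n, null (lincomb b c) -> c = 0.

Definition inf_sup l m (w : 'I_l -> wvfield R) (q : 'I_m -> wfield R) : Prop :=
  (0 < ereal_inf
    [set ereal_sup
      [set (ip (div v) r.1 / (L2norm r.1 * L2norm_mat (jac v)))%:E
        | v in lin_span w `&` [set v | ~ null_vfield v]]
    | r in lin_span q `&` [set r | ~ null_field r]])%E.

Section matrices.
Context (l m : nat) (w : 'I_l -> wvfield R) (q : 'I_m -> wfield R).
Context (k nu alpha rho : R).

Definition matA : 'M[R]_l := \matrix_(i, j)
  (3 / 2 * ip_vec (vel (w i)) (vel (w j))
   + k * nu * ip_mat (jac (w i)) (jac (w j))).

Definition matB : 'M[R]_(m, l) := \matrix_(i, j) - ip (q i).1 (div (w j)).

Definition matG : 'M[R]_m := \matrix_(i, j) ip_vec (q i).2 (q j).2.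

Definition matM : 'M[R]_m := \matrix_(i, j) ip (q i).1 (q j).1.

Definition matK : 'M[R]_m :=
  (alpha *: invmx matG + (rho * k) *: invmx matM)
  *m matB *m invmx matA *m matB^T.

End matrices.

End fields.

(* The spectrum is taken over the complex numbers. *)
Definition spr (R : realType) n (A : 'M[R]_n) : R :=
  sup [set ComplexField.Normc.normc z
      | z in [set z : R[i] | eigenvalue (map_mx (real_complex R) A) z]].

Definition is_eigenbasis (R : realType) m (K : 'M[R]_m)
    (xi : m.-tuple 'cV[R]_m) : Prop :=
  basis_of {:'cV[R]_m} xi /\
  forall j, exists a : R, K *m tnth xi j = a *: tnth xi j.

Definition norm_inf_basis (R : realType) m (xi : m.-tuple 'cV[R]_m)
    (x : 'cV[R]_m) : R :=
  \big[Num.max/0]_(j < m) `|coord xi j x|.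

Definition is_norm_on (R : realType) (V : lmodType R) (S : set V)
    (N : V -> R) : Prop :=
  [/\ forall x, S x -> 0 <= N x,
      forall x, S x -> N x = 0 -> x = 0,
      forall x y, S x -> S y -> N (x + y) <= N x + N y &
      forall a x, S x -> N (a *: x) = `|a| * N x].

(* Main.v *)
(* The error coefficients satisfy pbar^(s+1) = (I - S T) pbar^s, where
   S = alpha G^-1 + rho k M^-1, T = B A^-1 B^T and K = S T.  In a basis of
   eigenvectors of K this is a diagonal iteration, whence the first bound.
   For the convergence, S and T are symmetric positive definite and
   T S T <= theta T with theta = max(alpha / 1.5, rho / nu), so that
   x^T S^-1 x contracts by a fixed factor when theta < 2; no diagonalization
   is needed.  The bound on T S T amounts to B^T S B <= theta A, that is, for
   v in V_h, to three facts: the L2 projection of v onto grad Q_h is no longer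
   than v, that of div v onto Q_h is no longer than div v, and
   ||div v|| <= ||grad v||.  The last one follows from
   (d_i v_i, d_j v_j) = (d_j v_i, d_i v_j), obtained by approximating one factor
   by test functions, whose mixed derivatives commute. *)
Require Import Defs.
From HB Require Import structures.
From mathcomp Require Import all_boot all_order all_algebra.
From mathcomp Require Import all_classical all_reals all_analysis.
From mathcomp Require Import measurable_realfun complex ring lra.
Set Implicit Arguments.
Unset Strict Implicit.
Unset Printing Implicit Defensive.
Import Order.TTheory GRing.Theory Num.Theory.
Import numFieldNormedType.Exports.
Local Open Scope classical_set_scope.
Local Open Scope ring_scope.

(** * Positive definite matrices and the preconditioned iteration *)

(** Evaluate at the minimiser -b/c when c > 0. If c = 0 the polynomial is affine, which forces b =
    0, and c < 0 is excluded by a large t. Both Cauchy-Schwarz inequalities below, for matrices and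
    for [ip], rest on this. *)
Lemma discriminant_le (R : realFieldType) (a b c : R) :
  (forall t, 0 <= a + 2 * t * b + t ^+ 2 * c) -> b ^+ 2 <= a * c.
Proof.
move=> h.
have c_ge0 : 0 <= c.
  have h' t : 0 <= a + t ^+ 2 * c by have := h t; have := h (- t); rewrite sqrrN; lra.
  have a0 := h' 0; rewrite expr0n /= mul0r addr0 in a0.
  rewrite leNgt; apply/negP => c0.
  (* Here t >= 1, so t^2 c <= t c = c - (a + 1), and the value at t is at most c - 1 < 0. *)
  have := h' (1 + (a + 1) / - c).
  have d0 : 0 <= (a + 1) / - c by rewrite divr_ge0//; lra.
  have dc : (a + 1) / - c * c = - (a + 1) by field; rewrite lt_eqF.
  by move: d0 dc; set d := _ / _ => d0 dc; nra.
have [c0|c0] := ltrP 0 c.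
  have := h (- (b / c)).
  rewrite (_ : a + _ + _ = (a * c - b ^+ 2) / c); last by field; rewrite gt_eqF.
  by rewrite pmulr_lge0 ?invr_gt0// subr_ge0.
have {c0 c_ge0} c0 : c = 0 by apply/le_anti; rewrite c0.
have [->|b0] := eqVneq b 0; first by rewrite c0 expr0n mulr0.
(* This t gives the affine function the value -1. *)
have := h (- ((a + 1) / (2 * b))).
by rewrite c0 (_ : 2 * _ * b = - (a + 1)); [lra|field].
Qed.

Section dot.
Context {R : realFieldType}.

Definition dot n (x y : 'cV[R]_n) : R := (x^T *m y) 0 0.

Lemma dotE n (x y : 'cV[R]_n) : dot x y = \sum_i x i 0 * y i 0.
Proof. by rewrite /dot mxE; apply: eq_bigr => i _; rewrite mxE. Qed.

Lemma dotC n (x y : 'cV[R]_n) : dot x y = dot y x.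
Proof. by rewrite !dotE; apply: eq_bigr => i _; rewrite mulrC. Qed.

Lemma dotDr n (x y z : 'cV[R]_n) : dot x (y + z) = dot x y + dot x z.
Proof. by rewrite /dot mulmxDr mxE. Qed.

Lemma dotDl n (x y z : 'cV[R]_n) : dot (y + z) x = dot y x + dot z x.
Proof. by rewrite dotC dotDr !(dotC x). Qed.

Lemma dotZr n a (x y : 'cV[R]_n) : dot x (a *: y) = a * dot x y.
Proof. by rewrite /dot -scalemxAr mxE. Qed.

Lemma dotZl n a (x y : 'cV[R]_n) : dot (a *: x) y = a * dot x y.
Proof. by rewrite dotC dotZr dotC. Qed.

Lemma dot0r n (x : 'cV[R]_n) : dot x 0 = 0.
Proof. by rewrite /dot mulmx0 mxE. Qed.

Lemma dotNr n (x y : 'cV[R]_n) : dot x (- y) = - dot x y.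
Proof. by rewrite -scaleN1r dotZr mulN1r. Qed.

Lemma dotNl n (x y : 'cV[R]_n) : dot (- x) y = - dot x y.
Proof. by rewrite dotC dotNr dotC. Qed.

Lemma dot_mulmx m n (P : 'M[R]_(m, n)) x y : dot x (P *m y) = dot (P^T *m x) y.
Proof. by rewrite /dot trmx_mul trmxK mulmxA. Qed.

Lemma dotxx_ge0 n (x : 'cV[R]_n) : 0 <= dot x x.
Proof. by rewrite dotE sumr_ge0// => i _; rewrite -expr2 sqr_ge0. Qed.

Lemma sqr_le_dot n (x : 'cV[R]_n) i : x i 0 ^+ 2 <= dot x x.
Proof.
rewrite dotE (bigD1 i)//= -expr2 lerDl sumr_ge0// => j _.
by rewrite -expr2 sqr_ge0.
Qed.

Lemma dotxx_eq0 n (x : 'cV[R]_n) : dot x x = 0 -> x = 0.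
Proof.
move=> x0; apply/colP => i; rewrite mxE; apply/eqP.
by rewrite -sqrf_eq0 eq_le sqr_ge0 -x0 sqr_le_dot.
Qed.

(** Each product |x_i x_j| is at most x.x, so the sum of the absolute values of the entries of P is
    a valid constant. *)
Lemma quadratic_form_bounded n (P : 'M[R]_n) :
  exists2 C, 0 <= C & forall x, dot x (P *m x) <= C * dot x x.
Proof.
exists (\sum_i \sum_j `|P i j|); first by do 2!apply: sumr_ge0 => ? _.
move=> x; rewrite {1}dotE mulr_suml; apply: ler_sum => i _.
rewrite mxE mulr_suml mulr_sumr; apply: ler_sum => j _.
have hi := sqr_le_dot x i; have hj := sqr_le_dot x j.
have hP := ler_norm (P i j); have hP' := ler_norm (- P i j).
rewrite normrN in hP'.
have h : `|x i 0 * x j 0| <= dot x x.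
  have := sqr_ge0 (x i 0 - x j 0); have := sqr_ge0 (x i 0 + x j 0).
  by rewrite ler_norml; nra.
rewrite mulrCA (le_trans (ler_norm _))// normrM.
by rewrite ler_wpM2l.
Qed.

Definition posdef n (P : 'M[R]_n) : Prop :=
  P^T = P /\ forall x, x != 0 -> 0 < dot x (P *m x).

Section posdef.
Context n (P : 'M[R]_n) (Ppd : posdef P).

Lemma posdef_ge0 x : 0 <= dot x (P *m x).
Proof.
have [->|x0] := eqVneq x 0; first by rewrite mulmx0 dot0r.
by rewrite ltW// (proj2 Ppd).
Qed.

Lemma posdef_sym x y : dot x (P *m y) = dot (P *m x) y.
Proof. by rewrite dot_mulmx (proj1 Ppd). Qed.

(** A nonzero row of the left kernel would, once transposed, be a nonzero vector of zero energy. *)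
Lemma posdef_unit : P \in unitmx.
Proof.
rewrite -row_free_unit; apply/row_freeP; apply/row_freeP.
rewrite -kermx_eq0; apply/eqP/row_matrixP => i; rewrite row0.
apply/trmx_inj; rewrite trmx0; apply/eqP/negP => /negP v0.
have := proj2 Ppd _ v0; rewrite dot_mulmx /dot trmx_mul !trmxK -row_mul.
by rewrite mulmx_ker row0 mul0mx mxE ltxx.
Qed.

Lemma posdef_inv : posdef (invmx P).
Proof.
split; first by rewrite trmx_inv (proj1 Ppd).
move=> x x0; have xE : x = P *m (invmx P *m x) by rewrite mulKVmx// posdef_unit.
rewrite {1}xE -posdef_sym; apply: (proj2 Ppd).
by apply/eqP => y0; move/eqP: x0; apply; rewrite xE y0 mulmx0.
Qed.

Lemma posdef_CauchySchwarz x y :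
  dot x (P *m y) ^+ 2 <= dot x (P *m x) * dot y (P *m y).
Proof.
apply: discriminant_le => t; have := posdef_ge0 (x + t *: y).
rewrite mulmxDr -scalemxAr !(dotDl, dotDr, dotZl, dotZr).
by rewrite (posdef_sym y x) (dotC _ x); lra.
Qed.

End posdef.

(** Cauchy-Schwarz with y = P^-1 x gives (x.x)^2 <= (x.Px)(x.P^-1 x), and the last factor is at most
    C x.x. Neither compactness nor eigenvalues enter. *)
Lemma posdef_coercive n (P : 'M[R]_n) : posdef P ->
  exists2 C, 0 <= C & forall x, dot x x <= C * dot x (P *m x).
Proof.
move=> Ppd; have [C C0 hC] := quadratic_form_bounded (invmx P).
exists C => // x.
have := posdef_CauchySchwarz Ppd x (invmx P *m x).
rewrite mulKVmx ?posdef_unit// (dotC _ x) => h.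
have [x0|x0] := eqVneq (dot x x) 0.
  by rewrite x0 mulr_ge0// posdef_ge0.
have xx : 0 < dot x x by rewrite lt_neqAle eq_sym x0 dotxx_ge0.
have := le_trans h (ler_wpM2l (posdef_ge0 Ppd x) (hC x)).
by rewrite expr2 mulrA ler_pM2r// mulrC.
Qed.

Lemma posdef_compare n (P Q : 'M[R]_n) : posdef P ->
  exists2 C, 0 <= C & forall x, dot x (Q *m x) <= C * dot x (P *m x).
Proof.
move=> Ppd; have [C C0 hC] := posdef_coercive Ppd.
have [D D0 hD] := quadratic_form_bounded Q.
exists (D * C); first exact: mulr_ge0.
by move=> x; rewrite (le_trans (hD x))// -mulrA ler_wpM2l.
Qed.

Lemma posdefD n (P Q : 'M[R]_n) (a b : R) : posdef P -> posdef Q ->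
  0 <= a -> 0 <= b -> (a, b) <> (0, 0) -> posdef (a *: P + b *: Q).
Proof.
move=> Ppd Qpd a0 b0 ab; split.
  by rewrite linearD !linearZ /= (proj1 Ppd) (proj1 Qpd).
move=> x x0; rewrite mulmxDl -!scalemxAl dotDr !dotZr.
have hP := proj2 Ppd x x0; have hQ := proj2 Qpd x x0.
have [a_gt0|a_le0] := ltrP 0 a.
  by rewrite ltr_pwDl ?mulr_gt0 ?mulr_ge0// ltW.
have ae : a = 0 by apply/le_anti; rewrite a0 a_le0.
rewrite ae mul0r add0r mulr_gt0// lt_neqAle b0 andbT.
by apply/eqP => be; apply: ab; rewrite ae -be.
Qed.

End dot.

(** * Energy contraction of the preconditioned Uzawa iteration *)

Section uzawa.
Context {R : realFieldType} (l m : nat).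
Context (A N L : 'M[R]_l) (G M : 'M[R]_m) (B : 'M[R]_(m, l)).
Context (beta k nu alpha rho : R).
Hypotheses (Apd : posdef A) (Gpd : posdef G) (Mpd : posdef M).
Hypothesis AE : A = beta *: N + (k * nu) *: L.
Hypothesis B_inj : forall x : 'cV_m, B^T *m x = 0 -> x = 0.
Hypotheses (N0 : forall y, 0 <= dot y (N *m y)) (L0 : forall y, 0 <= dot y (L *m y)).
Hypothesis BGN : forall x y, 2 * dot x (B *m y) <= dot x (G *m x) + dot y (N *m y).
Hypothesis BML : forall x y, 2 * dot x (B *m y) <= dot x (M *m x) + dot y (L *m y).
Hypotheses (beta0 : 0 < beta) (k0 : 0 < k) (nu0 : 0 < nu).
Hypotheses (alpha0 : 0 <= alpha) (rho0 : 0 <= rho).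
Hypothesis ar0 : (alpha, rho) <> (0, 0).

Let S := alpha *: invmx G + (rho * k) *: invmx M.
Let T := B *m invmx A *m B^T.
Let theta := Num.max (alpha / beta) (rho / nu).

Lemma precond_posdef : posdef S.
Proof.
apply: posdefD; rewrite ?mulr_ge0 ?(ltW k0)//; try exact: posdef_inv.
case=> a0 /eqP; rewrite mulf_eq0 (gt_eqF k0) orbF => /eqP r0.
by apply: ar0; rewrite a0 r0.
Qed.

Lemma schur_form x : dot x (T *m x) = dot (B^T *m x) (invmx A *m (B^T *m x)).
Proof. by rewrite /T -!mulmxA dot_mulmx. Qed.

Lemma schur_posdef : posdef T.
Proof.
split; first by rewrite /T !trmx_mul trmxK trmx_inv (proj1 Apd) mulmxA.
move=> x x0; rewrite schur_form; apply: (proj2 (posdef_inv Apd)).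
by apply/eqP => /B_inj xe; rewrite xe eqxx in x0.
Qed.

(** With x = G^-1 B y, [BGN] reads 2d <= d + y.Ny for d = By.G^-1 By, that is d <= y.Ny; [BML] with
    x = M^-1 B y does the same for M and L. The weights compare through alpha <= theta beta and rho
    <= theta nu. *)
Lemma precond_form_le y :
  dot (B *m y) (S *m (B *m y)) <= theta * dot y (A *m y).
Proof.
have hG : dot (B *m y) (invmx G *m (B *m y)) <= dot y (N *m y).
  have := BGN (invmx G *m (B *m y)) y.
  by rewrite mulKVmx ?posdef_unit// -(dotC (B *m y)); lra.
have hM : dot (B *m y) (invmx M *m (B *m y)) <= dot y (L *m y).
  have := BML (invmx M *m (B *m y)) y.
  by rewrite mulKVmx ?posdef_unit// -(dotC (B *m y)); lra.
rewrite /S AE !mulmxDl -!scalemxAl !dotDr !dotZr mulrDr.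
have h1 : alpha <= theta * beta.
  by rewrite -ler_pdivrMr// le_max lexx.
have h2 : rho <= theta * nu.
  by rewrite -ler_pdivrMr// le_max lexx orbT.
apply: lerD.
  by rewrite mulrA (le_trans (ler_wpM2l alpha0 hG))// ler_wpM2r.
rewrite (mulrC k) !mulrA (le_trans (ler_wpM2l _ hM))//.
  by rewrite mulr_ge0// ltW.
by rewrite ler_wpM2r// ler_wpM2r// ltW.
Qed.

Hypothesis theta_lt2 : theta < 2.

(* Energy [x^T S^-1 x]; writing [y = A^-1 B^T x], one has [T x = B y] and
   [y^T A y = x^T T x], whence [(T x)^T S (T x) <= theta x^T T x]. *)
Lemma uzawa_energy_contraction :
  exists g, [/\ 0 < g, g < 1 & forall x,
    let x' := (1%:M - S *m T) *m x in
    dot x' (invmx S *m x') <= g * dot x (invmx S *m x)].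
Proof.
have Spd := precond_posdef; have Tpd := schur_posdef.
have Su := posdef_unit Spd.
have [C C0 hC] := posdef_compare (invmx S) Tpd.
(* D has to dominate C, and to exceed 2 - theta so that the factor 1 - (2 - theta) / D stays
   positive. *)
pose D := C + 3; have D0 : 0 < D by rewrite /D; lra.
have th0 : 0 <= theta by rewrite le_max divr_ge0// ltW.
have e0 : 0 < (2 - theta) / D by rewrite divr_gt0// subr_gt0.
exists (1 - (2 - theta) / D); split.
- rewrite subr_gt0 ltr_pdivrMr// mul1r /D; lra.
- by rewrite ltrBlDr ltrDl.
move=> x /=; rewrite mulmxBl mul1mx -(mulmxA S).
set t := T *m x.
have TST : dot t (S *m t) <= theta * dot x t.
  pose y := invmx A *m (B^T *m x).
  have tE : t = B *m y by rewrite /t /T /y !mulmxA.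
  rewrite tE (le_trans (precond_form_le _))//.
  by rewrite mulKVmx ?posdef_unit// (dot_mulmx B) dotC.
have hx := hC x; rewrite -/t in hx.
have xt0 : 0 <= dot x t by exact: posdef_ge0.
rewrite mulmxBr mulKmx// !(dotDl, dotDr, dotNl, dotNr).
rewrite (_ : dot (S *m t) (invmx S *m x) = dot x t); last first.
  by rewrite -(posdef_sym Spd) mulKVmx// dotC.
rewrite (dotC (S *m t)).
(* The new energy is x.S^-1 x - 2 x.t + t.St, at most x.S^-1 x - (2 - theta) x.t by [TST]. *)
suff : (2 - theta) / D * dot x (invmx S *m x) <= (2 - theta) * dot x t by lra.
rewrite -mulrA ler_wpM2l ?subr_ge0 ?(ltW theta_lt2)//.
rewrite ler_pdivrMl// (le_trans hx)// ler_wpM2r// /D; lra.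
Qed.

End uzawa.

(** The energy is quadratic, so a factor g on it is a factor sqrt g on the entries, which coercivity
    of E bounds by the energy. *)
Lemma geometric_decay (R : rcfType) n (P E : 'M[R]_n) (g : R) :
  posdef E -> 0 < g < 1 ->
  (forall x, let x' := P *m x in dot x' (E *m x') <= g * dot x (E *m x)) ->
  forall x : nat -> 'cV[R]_n, (forall s, x s.+1 = P *m x s) ->
  exists2 c, 0 <= c & forall s i, `|x s i 0| <= c * Num.sqrt g ^+ s.
Proof.
move=> Epd /andP[g0 g1] hP x xS; have [C C0 hC] := posdef_coercive Epd.
have E0 := posdef_ge0 Epd.
exists (Num.sqrt (C * dot (x 0%N) (E *m x 0%N))) => [|s i].
  exact: sqrtr_ge0.
have hs : dot (x s) (E *m x s) <= g ^+ s * dot (x 0%N) (E *m x 0%N).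
  elim: s => [|s IH]; first by rewrite expr0 mul1r.
  rewrite xS (le_trans (hP _))// exprS -mulrA ler_wpM2l// ltW//.
rewrite -ler_sqr ?nnegrE ?mulr_ge0 ?exprn_ge0 ?sqrtr_ge0//.
rewrite real_normK ?num_real// exprMn sqr_sqrtr ?mulr_ge0//.
rewrite exprAC sqr_sqrtr ?(ltW g0)// (le_trans (sqr_le_dot _ _))//.
by rewrite (le_trans (hC _))// -mulrA ler_wpM2l// mulrC.
Qed.

(** * Spectral radius and the maximum norm in an eigenbasis *)

Lemma eigenvalue_trmx (F : fieldType) n (A : 'M[F]_n) a :
  eigenvalue A^T a = eigenvalue A a.
Proof.
rewrite !eigenvalue_root_char; congr (root _ a).
rewrite /char_poly -det_tr; congr (\det _); apply/matrixP => i j.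
by rewrite !mxE eq_sym.
Qed.

(** A real eigenvalue is a root of the complexified characteristic polynomial. For [sup] to bound
    its modulus the set of moduli must be bounded above; the sum of the moduli of all roots is such
    a bound. *)
Lemma eigenvalue_le_spr (R : realType) n (A : 'M[R]_n) a :
  eigenvalue A a -> `|a| <= spr A.
Proof.
move=> Aa; apply: ub_le_sup; last first.
  exists (real_complex R a); last by rewrite /= expr0n addr0 sqrtr_sqr.
  by rewrite /= eigenvalue_root_char -map_char_poly fmorph_root -eigenvalue_root_char.
pose p := char_poly (map_mx (real_complex R) A).
have [r pE] := closed_field_poly_normal p.
exists (\sum_(z <- r) ComplexField.Normc.normc z) => _ [z /= zA <-].
have zr : z \in r.
  move: zA; rewrite eigenvalue_root_char -/p pE rootZ ?root_prod_XsubC//.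
  by rewrite lead_coef_eq0 monic_neq0// char_poly_monic.
rewrite (big_rem z)//= lerDl sumr_ge0// => -[x y] _ /=.
exact: sqrtr_ge0.
Qed.

(** I - K multiplies the j-th coordinate by 1 - a_j, where a_j is the eigenvalue of the j-th basis
    vector, and 1 - a_j is an eigenvalue of I - K. *)
Lemma norm_inf_basis_contraction (R : realType) m (K : 'M[R]_m)
    (xi : m.-tuple 'cV[R]_m) (x : 'cV[R]_m) : is_eigenbasis K xi ->
  norm_inf_basis xi ((1%:M - K) *m x)
    <= spr (1%:M - K) * norm_inf_basis xi x.
Proof.
case=> xib xiK.
have xif : free xi := basis_free xib.
have spr_ge j (a : R) : K *m tnth xi j = a *: tnth xi j ->
    (* [eigenvalue] refers to row eigenvectors whereas the basis consists of columns, hence the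
       passage to the transpose. *)
    `|1 - a| <= spr (1%:M - K).
  move=> Ka; apply: eigenvalue_le_spr; rewrite -eigenvalue_trmx.
  apply/eigenvalueP; exists (tnth xi j)^T.
    by rewrite -trmx_mul mulmxBl mul1mx Ka -linearZ/= scalerBl scale1r.
  apply/eqP => /(congr1 trmx); rewrite trmxK trmx0 => x0.
  have /(free_not0 xif) : tnth xi j \in xi by exact: mem_tnth.
  by rewrite x0 eqxx.
have coordK j a : K *m tnth xi j = a *: tnth xi j ->
    coord xi j ((1%:M - K) *m x) = (1 - a) * coord xi j x.
  move=> Ka; rewrite {1}(coord_basis xib (memvf x)) mulmx_sumr linear_sum /=.
  rewrite (bigD1 j)//= big1 ?addr0.
    rewrite -(tnth_nth 0) -scalemxAr mulmxBl mul1mx Ka -[X in X - _]scale1r.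
    rewrite -scalerBl !linearZ /= (tnth_nth 0) coord_free// eqxx mulr1.
    by rewrite mulrC.
  move=> i ij; have [b Kb] := xiK i.
  rewrite -(tnth_nth 0) -scalemxAr mulmxBl mul1mx Kb -[X in X - _]scale1r.
  rewrite -scalerBl !linearZ /= (tnth_nth 0) coord_free// (negbTE ij).
  by rewrite !mulr0.
rewrite /norm_inf_basis; apply/bigmax_leP; split.
  have norm0 : 0 <= norm_inf_basis xi x.
    by rewrite /norm_inf_basis; apply: bigmax_ge_id.
  (* The spectral radius is seen to be nonnegative from an eigenvalue, which takes m > 0; for m = 0
     the maximum is empty and equals its default 0. *)
  have [m0|m0] := posnP m.
    rewrite (_ : \big[_/_]_(j < m) _ = 0) ?mulr0//.
    by apply: big_pred0 => -[j jm]; move: (jm); rewrite {1}m0.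
  have [a Ka] := xiK (Ordinal m0).
  by rewrite mulr_ge0// (le_trans _ (spr_ge _ _ Ka)).
move=> j _; have [a Ka] := xiK j; rewrite (coordK _ _ Ka) normrM.
have h := spr_ge _ _ Ka.
by apply: ler_pM => //; apply: (@le_bigmax _ _ _ 0 (fun j => `|coord xi j x|)).
Qed.

(** * The L2 inner product *)

Section L2.
Context (R : realType) (Omega : set (R3 R)).
Implicit Types (f g h : R3 R -> R).
Local Notation L2 := (L2 Omega).
Local Notation ip := (ip Omega).

Let Lfun2_closed : submod_closed (Lfun (leb3 R) 2%:E).
Proof. by apply: Lfun_submod_closed; rewrite lee_fin ler1n. Qed.

Lemma L20 : L2 0.
Proof.
rewrite /Defs.L2/= (_ : _ \_ _ = 0); first exact: (proj1 Lfun2_closed).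
by apply/funext => x; rewrite patchE; case: ifP.
Qed.

Lemma L2_linear a f g : L2 f -> L2 g -> L2 (a *: f + g).
Proof.
rewrite /Defs.L2/= => hf hg.
rewrite (_ : _ \_ _ = a *: (f \_ Omega) + g \_ Omega).
  exact: (proj2 Lfun2_closed).
apply/funext => x; rewrite !fctE !patchE; case: ifP => // _.
by rewrite scaler0 addr0.
Qed.

Lemma L2D f g : L2 f -> L2 g -> L2 (f + g).
Proof. by move=> *; rewrite -[f]scale1r; exact: L2_linear. Qed.

Lemma L2Z a f : L2 f -> L2 (a *: f).
Proof. by move=> *; rewrite -[_ *: _]addr0; apply: L2_linear; last exact: L20. Qed.

Lemma L2N f : L2 f -> L2 (- f).
Proof. by move=> ?; rewrite -scaleN1r; exact: L2Z. Qed.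

Lemma L2B f g : L2 f -> L2 g -> L2 (f - g).
Proof. by move=> ? ?; apply: L2D => //; exact: L2N. Qed.

Lemma L2_sum (I : Type) (s : seq I) (P : pred I) (F : I -> R3 R -> R) :
  (forall i, P i -> L2 (F i)) -> L2 (\sum_(i <- s | P i) F i).
Proof. by move=> h; apply: big_ind => //; [exact: L20|exact: L2D]. Qed.

(** [L2] is a condition on the extension by zero, so integrability is obtained for the product of
    the extensions. *)
Lemma ipE f g : ip f g = \int[leb3 R]_x ((f \_ Omega) x * (g \_ Omega) x).
Proof.
rewrite /Defs.ip Rintegral_mkcond; apply: eq_Rintegral => x _.
by rewrite !patchE; case: ifP => // _; rewrite mulr0.
Qed.

Lemma integrable_ip f g : L2 f -> L2 g ->
  (leb3 R).-integrable setT (EFin \o (fun x => (f \_ Omega) x * (g \_ Omega) x)).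
Proof. by move=> hf hg; apply/Lfun1_integrable; exact: Lfun2_mul_Lfun1. Qed.

Lemma ipC f g : ip f g = ip g f.
Proof. by apply: eq_Rintegral => x _; rewrite mulrC. Qed.

Lemma ipDl f g h : L2 f -> L2 g -> L2 h -> ip (f + g) h = ip f h + ip g h.
Proof.
move=> hf hg hh; rewrite !ipE -RintegralD//; try exact: integrable_ip.
apply: eq_Rintegral => x _; rewrite -mulrDl !patchE; case: ifP => // _.
by rewrite addr0.
Qed.

Lemma ipZl a f g : L2 f -> L2 g -> ip (a *: f) g = a * ip f g.
Proof.
move=> hf hg; rewrite !ipE -RintegralZl//; try exact: integrable_ip.
apply: eq_Rintegral => x _; rewrite mulrA !patchE; case: ifP => // _.
by rewrite [RHS]mulr0 mulr0.
Qed.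

Lemma ip0l f : ip 0 f = 0.
Proof.
rewrite /Defs.ip (@eq_Rintegral _ _ _ _ _ (cst 0)).
  by rewrite Rintegral_mkcond (_ : _ \_ _ = cst 0) ?Rintegral_cst ?mul0r//;
    apply/funext => x; rewrite patchE; case: ifP.
by move=> x _; rewrite mul0r.
Qed.

Lemma ip_ge0 f : 0 <= ip f f.
Proof. by apply: Rintegral_ge0 => x _; rewrite -expr2 sqr_ge0. Qed.

Lemma ipDr f g h : L2 f -> L2 g -> L2 h -> ip h (f + g) = ip h f + ip h g.
Proof. by move=> *; rewrite ipC ipDl// !(ipC h). Qed.

Lemma ipZr a f g : L2 f -> L2 g -> ip g (a *: f) = a * ip g f.
Proof. by move=> *; rewrite ipC ipZl// ipC. Qed.

Lemma ipNl f g : L2 f -> L2 g -> ip (- f) g = - ip f g.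
Proof. by move=> *; rewrite -scaleN1r ipZl// mulN1r. Qed.

Lemma ipNr f g : L2 f -> L2 g -> ip g (- f) = - ip g f.
Proof. by move=> *; rewrite ipC ipNl// ipC. Qed.

Lemma ipBr f g h : L2 f -> L2 g -> L2 h -> ip h (f - g) = ip h f - ip h g.
Proof. by move=> *; rewrite ipDr ?ipNr//; exact: L2N. Qed.

Lemma ip_suml (I : Type) (s : seq I) (P : pred I) (F : I -> R3 R -> R) g :
  (forall i, P i -> L2 (F i)) -> L2 g ->
  ip (\sum_(i <- s | P i) F i) g = \sum_(i <- s | P i) ip (F i) g.
Proof.
move=> hF hg; elim: s => [|i s IH]; first by rewrite !big_nil ip0l.
rewrite !big_cons; case: ifP => // Pi.
by rewrite ipDl ?IH//; [exact: hF|exact: L2_sum].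
Qed.

Lemma ip_sumr (I : Type) (s : seq I) (P : pred I) (F : I -> R3 R -> R) g :
  (forall i, P i -> L2 (F i)) -> L2 g ->
  ip g (\sum_(i <- s | P i) F i) = \sum_(i <- s | P i) ip g (F i).
Proof. by move=> *; rewrite ipC ip_suml//; apply: eq_bigr => *; exact: ipC. Qed.

Lemma ip_young f g : L2 f -> L2 g -> 2 * ip f g <= ip f f + ip g g.
Proof.
move=> hf hg; have := ip_ge0 (f - g).
have hfg : L2 (f - g) by exact: L2B.
rewrite ipBr// (ipC _ f) (ipC _ g) !ipBr// (ipC g f); lra.
Qed.

Lemma ip_CauchySchwarz f g : L2 f -> L2 g ->
  `|ip f g| <= L2norm Omega f * L2norm Omega g.
Proof.
move=> hf hg; rewrite -ler_sqr ?nnegrE ?mulr_ge0 ?sqrtr_ge0//.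
rewrite real_normK ?num_real// exprMn !sqr_sqrtr ?ip_ge0//.
apply: discriminant_le => t; have := ip_ge0 (f + t *: g).
have hg' : L2 (t *: g) by exact: L2Z.
have hfg : L2 (f + t *: g) by exact: L2D.
rewrite ipDr// (ipC _ f) (ipC _ (t *: g)) !ipDr// !ipZl// !ipZr// (ipC g f).
by lra.
Qed.

Lemma ip_eq0 f : L2 f -> ip f f = 0 ->
  {ae leb3 R, forall x, Omega x -> f x = 0}.
Proof.
move=> hf; rewrite ipE => ff0.
have fi := integrable_ip hf hf.
have mf := measurable_int _ fi.
have [aeP _] := ae_eq_integral_abs (leb3 R) measurableT mf.
apply: (filterS _ (aeP _)).
  move=> x /= /(_ I) [] /eqP; rewrite mulf_eq0 orbb => /eqP.
  by rewrite patchE => fx0 Ox; rewrite mem_set in fx0.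
under eq_integral => x _ do rewrite /= normrM -expr2 real_normK ?num_real//.
under eq_integral => x _ do rewrite expr2.
(* The real integral is the [fine] part of the extended one, and [fine] also sends infinity to 0;
   finiteness comes from integrability. *)
rewrite -[LHS]fineK; last exact: integrable_fin_num.
by congr (_%:E).
Qed.

Lemma ip_cvg f g (gn : nat -> R3 R -> R) : L2 f -> L2 g ->
  (forall n, L2 (gn n)) -> L2norm Omega (gn n - g) @[n --> \oo] --> (0 : R) ->
  ip f (gn n) @[n --> \oo] --> ip f g.
Proof.
move=> hf hg hgn gng; apply/cvgrPdist_le => /= e e0.
have L0 : 0 <= L2norm Omega f by exact: sqrtr_ge0.
(* Adding 1 keeps the denominator positive when f has norm 0. *)
have d0 : 0 < e / (L2norm Omega f + 1) by rewrite divr_gt0// ltr_wpDl.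
move/cvgrPdist_le : gng => /(_ _ d0); apply: filterS => n.
rewrite sub0r normrN ger0_norm ?sqrtr_ge0// => hn.
rewrite distrC -ipBr// (le_trans (ip_CauchySchwarz _ _))//; first exact: L2B.
rewrite (le_trans (ler_wpM2l L0 hn))// mulrCA ger_pMr//.
by rewrite ler_pdivrMr ?ltr_wpDl// mul1r lerDl.
Qed.

End L2.

(** * Test functions *)

Section R3_measurable.
Context (R : realType).
Local Notation mR := (measurableTypeR R).
Local Notation mR3 := (mR * mR * mR)%type.

(** Balls of the product metric are cubes, that is, products of open intervals. *)
Lemma measurable_ball_R3 (x : mR3) (e : R) : measurable (ball x e : set mR3).
Proof.
have mb (y : mR) : measurable (ball y e : set mR).
  have := @measurable_itv R `](y : R) - e, (y : R) + e[.
  by rewrite -ball_itv.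
rewrite (_ : ball x e = (ball x.1.1 e `*` ball x.1.2 e) `*` ball x.2 e).
  exact: (@measurableX _ _ (mR * mR)%type mR _ _ (measurableX (mb _) (mb _)) (mb _)).
by apply/seteqP; split.
Qed.

Lemma ball_rat_R3 (x : mR3) (e : R) : 0 < e ->
  exists c : rat * rat * rat, ball ((ratr c.1.1, ratr c.1.2, ratr c.2) : mR3) e x.
Proof.
move=> e0; have h (t : R) : exists c : rat, ball (ratr c : mR) e t.
  have /rat_in_itvoo[c /itvP hc] : t < t + e by rewrite ltrDl.
  exists c; rewrite /ball /=; change (`|(ratr c : R) - t| < e).
  by rewrite ltr_distl hc (lt_trans _ (_ : t < _)) ?hc// ltrBlDr ltrDl.
have [a ha] := h x.1.1; have [b hb] := h x.1.2; have [c hc] := h x.2.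
by exists (a, b, c).
Qed.

(** U is the union of the countably many cubes with rational centre and radius 1/(n+1) that it
    contains. *)
Lemma open_measurable_R3 (U : set mR3) : open U -> measurable U.
Proof.
move=> oU.
pose V (i : rat * rat * rat * nat) : set mR3 :=
  ball ((ratr i.1.1.1, ratr i.1.1.2, ratr i.1.2) : mR3) i.2.+1%:R^-1.
rewrite (_ : U = \bigcup_i (if `[< V i `<=` U >] then V i else set0)).
  apply: countable_bigcupT_measurable => [|i]; first exact: countableP.
  by case: ifP => _; [exact: measurable_ball_R3|exact: measurable0].
apply/seteqP; split=> [x Ux|x [i _]]; last first.
  by case: asboolP => // VU /VU.
have /nbhs_ballP[e /= e0 xeU] := oU x Ux.
(* Below e/2, a cube containing x lies within distance e of x by the triangle inequality. *)
have [n hn] : exists n, n.+1%:R^-1 < e / 2.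
  have [n _ /(_ n (leqnn n))] := near_infty_natSinv_lt (PosNum (divr_gt0 e0 (ltr0n R 2))).
  by move=> hn; exists n; exact: hn.
have n0 : (0 : R) < n.+1%:R^-1 by rewrite invr_gt0.
have [c hc] := ball_rat_R3 x n0.
exists (c, n) => //; case: asboolP => // -[] y /= hy.
apply: xeU; rewrite (splitr e).
apply: ball_triangle (le_ball (ltW hn) _) (le_ball (ltW hn) hy).
exact: ball_sym.
Qed.

Lemma continuous_measurable_R3 (f : mR3 -> R) :
  continuous f -> measurable_fun setT f.
Proof.
move=> /continuousP cf; apply: (measurability _ (RGenOpens.measurableE R)).
move=> _ [_ [a [b ->] <-]]; rewrite setTI; apply: open_measurable_R3.
exact/cf/interval_open.
Qed.

(** K is enclosed in the cube [-N, N]^3, which is measurable whatever K is. *)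
Lemma bounded_leb3_lty (K : set (R3 R)) : bounded_set K ->
  exists2 B : set mR3, K `<=` B & measurable B /\ (leb3 R B < +oo)%E.
Proof.
case=> M [Mreal hM]; pose N := M + 1.
have {}hM x : K x -> `|x| <= N by apply: (hM N); rewrite ltrDl.
have mI : measurable (`[- N, N]%classic : set mR) by exact: (@measurable_itv R).
exists ((`[- N, N] `*` `[- N, N]) `*` `[- N, N]).
  move=> x /hM; rewrite prod_normE/= ge_max => /andP[].
  rewrite prod_normE/= ge_max => /andP[].
  by rewrite !ler_norml => h1 h2 h3; split; [split|]; rewrite /= in_itv.
split; first by apply: measurableX => //; exact: measurableX.
have mII := measurableX mI mI.
have E2 := product_measure1E (@lebesgue_measure R) (@lebesgue_measure R) mI mI.
have E3 := product_measure1E (@lebesgue_measure R \x @lebesgue_measure R)%E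
  (@lebesgue_measure R) mII mI.
rewrite [X in (X < _)%E](E3 : leb3 R _ = _) [X in (X * _)%E]E2.
have [r rE] : exists r, @lebesgue_measure R (`[- N, N]%classic : set mR) = r%:E.
  have := lebesgue_measure_itv `[- N, N]; rewrite /=.
  by case: ifP => _ ->; [exists (N - - N)|exists 0].
suff fin (a b c : \bar R) : a = r%:E -> b = r%:E -> c = r%:E ->
    (a * b * c < +oo)%E by exact: (fin _ _ _ rE rE rE).
by move=> -> -> ->; rewrite -!EFinM ltry.
Qed.

End R3_measurable.

(** * Test functions are square integrable and stable under differentiation *)

Section test_functions.
Context (R : realType) (Omega : set (R3 R)).
Local Notation mR := (measurableTypeR R).
Local Notation mR3 := (mR * mR * mR)%type.

Lemma L2_bounded_support (f : mR3 -> R) (K : set mR3) (C : R) :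
  measurable_fun setT f -> (forall x, `|f x| <= C) ->
  bounded_set K -> K `<=` Omega -> (forall x, ~ K x -> f x = 0) ->
  L2 Omega f.
Proof.
move=> mf fC bK KO fK; rewrite /L2/=.
rewrite (_ : f \_ Omega = f); last first.
  apply/funext => x; rewrite patchE; case: ifPn => // /negP xO.
  by rewrite fK// => /KO /mem_set.
have [B KB [mB Blty]] := bounded_leb3_lty bK.
apply/andP; split; first by rewrite inE.
rewrite inE /= /finite_norm unlock /= poweR_lty//.
rewrite (_ : (fun x => _) = (fun x => ((`|f x| `^ 2)%:E)) \_ B); last first.
  apply/funext => x; rewrite patchE; case: ifPn => // /negP xB.
  rewrite fK ?normr0 ?powR0// => Kx; apply: xB; apply: mem_set.
  exact: KB.
rewrite -integral_mkcond.
apply: (@le_lt_trans _ _ (\int[leb3 R]_(x in B) (C ^+ 2)%:E)%E).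
  apply: ge0_le_integral => //.
  - apply/measurable_EFinP.
    apply: (measurableT_comp (measurable_powR _)) => //.
    by apply: measurableT_comp => //; exact: measurable_funTS.
  - by move=> x _; rewrite lee_fin powR_mulrn// lerXn2r ?nnegrE// (le_trans _ (fC x)).
rewrite integral_cst//.
by rewrite -ge0_fin_numE// in Blty; rewrite -(fineK Blty) -EFinM ltry.
Qed.

Lemma smooth_partial i (f : R3 R -> R) : smooth f -> smooth (partial i f).
Proof. by move=> sf s; have := sf (rcons s i); rewrite foldr_rcons. Qed.

Lemma compact_R3_closed (K : set mR3) : compact K -> closed K.
Proof. by apply: compact_closed; exact: norm_hausdorff. Qed.

Lemma test_function_L2 f : test_function Omega f -> L2 Omega f.
Proof.
case=> sf [K [cK KO fK]].
have cf : continuous f := (sf [::]).1.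
have bK : bounded_set K by exact: compact_bounded.
have cfK : compact (f @` K).
  by apply: continuous_compact => //; exact: continuous_subspaceT.
have [M [Mr hM]] := compact_bounded cfK.
(* The 0 takes care of the points outside K, since M may be negative when K is empty. *)
pose C := Num.max 0 (M + 1).
apply: (@L2_bounded_support f K C) => //.
  exact: continuous_measurable_R3.
move=> x; have [Kx|nKx] := pselect (K x); last first.
  by rewrite fK// normr0 le_max lexx.
rewrite le_max; apply/orP; right; apply: (hM (M + 1)); rewrite ?ltrDl//.
Qed.

(** The same K serves: its complement is open, so f vanishes near each point outside K and so does
    its derivative there. *)
Lemma test_function_partial i f :
  test_function Omega f -> test_function Omega (partial i f).
Proof.
case=> sf [K [cK KO fK]]; split; first exact: smooth_partial.
exists K; split => // x nKx.
rewrite /partial (near_eq_derive (g := cst 0)) ?derive_cst//.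
have oK : open (~` K) by apply: closed_openC; exact: compact_R3_closed.
by apply: filterS (open_nbhs_nbhs (conj oK nKx)) => y nKy; rewrite fK.
Qed.

End test_functions.

(** * Symmetry of mixed directional derivatives *)

Section clairaut.
Context (R : realType) (V : normedModType R).
Implicit Types (f : V -> R) (u v x : V).

Lemma is_derive_line f v x (t : R) : derivable f (x + t *: v) v ->
  is_derive t 1 (fun s : R => f (x + s *: v)) ('D_v f (x + t *: v)).
Proof.
have E : (fun h : R => h^-1 *: ((fun s : R => f (x + s *: v)) (h *: 1 + t)
      - (fun s : R => f (x + s *: v)) t))
    = (fun h : R => h^-1 *: (f (h *: v + (x + t *: v)) - f (x + t *: v))).
  apply/funext => h /=; congr (_ *: (f _ - _)).
  by rewrite scalerDl /GRing.scale /= mulr1 addrCA.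
move=> fv; split; first by rewrite /derivable E.
by rewrite /derive E.
Qed.

Lemma mean_value_line f v x (t : R) : (forall y, derivable f y v) -> 0 < t ->
  exists2 c, 0 < c < t & f (x + t *: v) - f x = 'D_v f (x + c *: v) * t.
Proof.
move=> fv t0.
have h (s : R) : is_derive s 1 (fun s : R => f (x + s *: v)) ('D_v f (x + s *: v)).
  exact: is_derive_line.
have cf : {within `[0, t], continuous (fun s : R => f (x + s *: v))}.
  apply: continuous_subspaceT => s; apply: differentiable_continuous.
  by apply/derivable1_diffP; have [] := h s.
have [c ct] := MVT t0 (fun s _ => h s) cf.
rewrite scale0r addr0 subr0 => fE; exists c => //.
Qed.

(** The mean value theorem is applied twice: to the increment of f along v as a function of the
    displacement along u, then to the derivative of f in direction u along v. *)
Lemma second_difference f u v x (t : R) :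
  (forall y, derivable f y u) -> (forall y, derivable ('D_u f) y v) -> 0 < t ->
  exists a b, [/\ 0 < a < t, 0 < b < t &
    f (x + t *: v + t *: u) - f (x + t *: u) - (f (x + t *: v) - f x)
    = 'D_v ('D_u f) (x + a *: u + b *: v) * t * t].
Proof.
move=> fu fuv t0.
pose phi (s : R) := f (x + t *: v + s *: u) - f (x + s *: u).
have h (s : R) : is_derive s 1 phi
    ('D_u f (x + t *: v + s *: u) - 'D_u f (x + s *: u)).
  by apply: is_deriveB; exact: is_derive_line.
have cphi : {within `[0, t], continuous phi}.
  apply: continuous_subspaceT => s; apply: differentiable_continuous.
  by apply/derivable1_diffP; have [] := h s.
have [a at_] := MVT t0 (fun s _ => h s) cphi.
rewrite /phi !scale0r !addr0 subr0 => fE.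
have [b bt bE] := mean_value_line (x + a *: u) fuv t0.
exists a, b; split => //.
by rewrite fE addrAC bE.
Qed.

(** The second difference is symmetric in u and v, so the two mixed derivatives agree at some pair
    of points as close to x as desired; continuity at x concludes. *)
Lemma clairaut f u v x :
  (forall y, derivable f y u) -> (forall y, derivable f y v) ->
  (forall y, derivable ('D_u f) y v) -> (forall y, derivable ('D_v f) y u) ->
  {for x, continuous ('D_v ('D_u f))} -> {for x, continuous ('D_u ('D_v f))} ->
  'D_v ('D_u f) x = 'D_u ('D_v f) x.
Proof.
move=> fu fv fuv fvu c1 c2; apply/eqP; rewrite -subr_eq0 -normr_le0.
apply/ler_addgt0Pr => e e0; rewrite add0r.
have swap (y1 y2 y3 y4 : R) : y1 - y2 - (y3 - y4) = y1 - y3 - (y2 - y4) by ring.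
have close (y1 y2 y : R) : `|y1 - y| < e / 2 -> `|y2 - y| < e / 2 ->
    `|y1 - y2| <= e.
  by rewrite !ltr_norml ler_norml; lra.
have e20 : 0 < e / 2 by rewrite divr_gt0.
move/cvgrPdist_lt : c1 => /(_ _ e20) c1.
move/cvgrPdist_lt : c2 => /(_ _ e20) c2.
have /nbhs_ballP[d /= d0 hd] : nbhs x [set y |
    `|'D_v ('D_u f) x - 'D_v ('D_u f) y| < e / 2 /\
    `|'D_u ('D_v f) x - 'D_u ('D_v f) y| < e / 2] by exact: filterI c1 c2.
pose n := `|u| + `|v| + 1.
have n0 : 0 < n by rewrite ltr_wpDl// addr_ge0.
(* For a, b < t, the displacement a u + b v is shorter than t n = d. *)
pose t := d / n; have t0 : 0 < t by rewrite divr_gt0.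
have near_x a b : 0 < a < t -> 0 < b < t -> ball x d (x + (a *: u + b *: v)).
  rewrite -ball_normE /ball_ /= => /andP[a0 at_] /andP[b0 bt].
  rewrite opprD addNKr normrN (le_lt_trans (ler_normD _ _))//.
  rewrite !normrZ !gtr0_norm//.
  have -> : d = t * n by rewrite /t divfK// gt_eqF.
  rewrite /n !mulrDr mulr1 (@le_lt_trans _ _ (t * `|u| + t * `|v|)) ?ltrDl//.
  by rewrite lerD// ler_wpM2r// ltW.
clearbody t.
have [a [b [ha hb E1]]] := second_difference x fu fuv t0.
have [a' [b' [ha' hb' E2]]] := second_difference x fv fvu t0.
have tt0 : t * t != 0 by rewrite mulf_neq0// gt_eqF.
have E : 'D_v ('D_u f) (x + (a *: u + b *: v))
    = 'D_u ('D_v f) (x + (b' *: u + a' *: v)).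
  rewrite -(addrA x (a *: u)) -mulrA in E1.
  rewrite -(addrA x (a' *: v)) -mulrA (addrC (a' *: v)) in E2.
  apply: (mulIf tt0); apply: etrans (esym E1) (etrans _ E2).
  rewrite (addrAC x (t *: u)); exact: swap.
have [h1 _] := hd _ (near_x _ _ ha hb).
have [_ h2] := hd _ (near_x _ _ hb' ha').
by rewrite -E in h2; exact: close h1 h2.
Qed.

End clairaut.

Lemma smooth_partialC (R : realType) (f : R3 R -> R) i j : smooth f ->
  partial i (partial j f) = partial j (partial i f).
Proof.
move=> sf; apply/funext => x; rewrite /partial; apply: clairaut.
- by have [_ d] := sf [::] => y; exact: d.
- by have [_ d] := sf [::] => y; exact: d.
- by have [_ d] := sf [:: j] => y; exact: d.
- by have [_ d] := sf [:: i] => y; exact: d.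
- by have [c _] := sf [:: i; j]; exact: c.
- by have [c _] := sf [:: j; i]; exact: c.
Qed.

(** * Sobolev fields and their Gram matrices *)

Section sobolev.
Context (R : realType) (Omega : set (R3 R)).
Local Notation L2 := (L2 Omega).
Local Notation ip := (ip Omega).

(** This is the definition of the weak derivative of q, tested with the approximants of v and passed
    to the limit on both sides. *)
Lemma H10_integration_by_parts (q v : wfield R) i : H1 Omega q -> H10 Omega v ->
  ip q.1 (v.2 i) = - ip (q.2 i) v.1.
Proof.
move=> [q2 hq] [[v2 hv] [phi [tphi phi_v dphi_v]]].
have [qi wq] := hq i; have [vi _] := hv i.
have c1 := @ip_cvg _ Omega _ _ _ q2 vi
  (fun n => test_function_L2 (test_function_partial i (tphi n))) (dphi_v i).
have c2 := @ip_cvg _ Omega _ _ _ qi v2 (fun n => test_function_L2 (tphi n)) phi_v.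
have {}c2 := cvgN c2.
rewrite (_ : (fun n => ip q.1 (partial i (phi n))) =
   (- (fun n => ip (q.2 i) (phi n)))) in c1; last first.
  by apply/funext => n; rewrite wq.
exact: (cvg_unique (@norm_hausdorff _ R^o) c1 (c2 _)).
Qed.

(** For a test function phi in place of g both sides equal -(f, d_i d_j phi), because the
    derivatives of phi are again test functions and commute. *)
Lemma H10_partial_swap (f g : wfield R) i j : H10 Omega f -> H10 Omega g ->
  ip (f.2 i) (g.2 j) = ip (f.2 j) (g.2 i).
Proof.
move=> [[f2 hf] _] [[g2 hg] [phi [tphi phi_g dphi_g]]].
have [fi wfi] := hf i; have [fj wfj] := hf j.
have [gi _] := hg i; have [gj _] := hg j.
have c1 := @ip_cvg _ Omega _ _ _ fi gj
  (fun n => test_function_L2 (test_function_partial j (tphi n))) (dphi_g j).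
have c2 := @ip_cvg _ Omega _ _ _ fj gi
  (fun n => test_function_L2 (test_function_partial i (tphi n))) (dphi_g i).
rewrite (_ : (fun n => ip (f.2 i) (partial j (phi n))) =
   (fun n => ip (f.2 j) (partial i (phi n)))) in c1; last first.
  apply/funext => n.
  have e1 := wfi _ (test_function_partial j (tphi n)).
  have e2 := wfj _ (test_function_partial i (tphi n)).
  have e3 := smooth_partialC i j (proj1 (tphi n)).
  by apply: oppr_inj; apply: etrans e2; apply: etrans (esym e1) _; rewrite e3.
exact: (cvg_unique (@norm_hausdorff _ R^o) c1 c2).
Qed.

(** Square integrability alone, without the link between value and gradient: it makes the forms
    bilinear and is immediate to propagate to spans. *)
Definition L2_wfield (q : wfield R) := L2 q.1 /\ forall i, L2 (q.2 i).

Definition L2_wvfield (v : wvfield R) := forall i, L2_wfield (v i).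

Lemma H1_L2_wfield q : H1 Omega q -> L2_wfield q.
Proof. by case=> ? h; split=> // i; have [] := h i. Qed.

Lemma H10_L2_wvfield (v : wvfield R) :
  (forall i, H10 Omega (v i)) -> L2_wvfield v.
Proof. by move=> h i; have [/H1_L2_wfield] := h i. Qed.

Lemma L2_wfield_linear a p q :
  L2_wfield p -> L2_wfield q -> L2_wfield (a *: p + q).
Proof.
move=> [p1 p2] [q1 q2]; split => [|i]; first exact: (L2_linear a p1 q1).
exact: (L2_linear a (p2 i) (q2 i)).
Qed.

Lemma L2_wvfield_linear a u v :
  L2_wvfield u -> L2_wvfield v -> L2_wvfield (a *: u + v).
Proof. by move=> hu hv i; apply: L2_wfield_linear. Qed.

Lemma divE (v : wvfield R) : div v = \sum_i jac v i i.
Proof. by apply/funext => x; rewrite fct_sumE. Qed.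

Lemma L2_div v : L2_wvfield v -> L2 (div v).
Proof. by move=> hv; rewrite divE; apply: L2_sum => i _; have [_ h] := hv i; exact: h. Qed.

Lemma div_linear a (u v : wvfield R) : div (a *: u + v) = a *: div u + div v.
Proof.
by rewrite !divE scaler_sumr -big_split.
Qed.

(** ||div v||^2 is the sum of (d_i v_i, d_j v_j) = (d_j v_i, d_i v_j), and Young's inequality on
    each term gives twice half of ||grad v||^2. *)
Lemma ip_div_le_ip_mat (v : wvfield R) : L2_wvfield v ->
  (forall i j, ip ((v i).2 i) ((v j).2 j) = ip ((v i).2 j) ((v j).2 i)) ->
  ip (div v) (div v) <= ip_mat Omega (jac v) (jac v).
Proof.
move=> hv vC; have h i j : L2 (jac v i j) by have [_ hi] := hv i; exact: hi.
rewrite divE ip_suml//; last by apply: L2_sum.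
under eq_bigr => i _ do rewrite ip_sumr//.
rewrite -(ler_pM2l (ltr0n R 2)) /ip_mat.
have -> : 2 * (\sum_i \sum_j ip (jac v i j) (jac v i j)) =
    \sum_i \sum_j (ip (jac v i j) (jac v i j) + ip (jac v j i) (jac v j i)).
  rewrite mulr_natl mulr2n; under [RHS]eq_bigr => i _ do rewrite big_split.
  by rewrite big_split /= [X in _ = _ + X]exchange_big.
rewrite mulr_sumr; apply: ler_sum => i _.
rewrite mulr_sumr; apply: ler_sum => j _.
by rewrite [ip _ _]vC; exact: (ip_young (h i j) (h j i)).
Qed.

End sobolev.

(** * Bilinear forms on spans and their Gram matrices *)

Section bilinear.
Context (R : realType).

Definition linear_closed_prop (V : lmodType R) (P : V -> Prop) :=
  P 0 /\ forall a x y, P x -> P y -> P (a *: x + y).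

(** Bilinearity is relative to predicates since additivity of the integral is available for
    integrable functions. *)
Definition bilinear_on (V W : lmodType R) (P : V -> Prop) (Q : W -> Prop)
    (b : V -> W -> R) :=
  (forall a x y z, P x -> P y -> Q z -> b (a *: x + y) z = a * b x z + b y z) /\
  (forall a x y z, P z -> Q x -> Q y -> b z (a *: x + y) = a * b z x + b z y).

Lemma bilinear_onD (V W : lmodType R) P Q (b c : V -> W -> R) :
  bilinear_on P Q b -> bilinear_on P Q c ->
  bilinear_on P Q (fun x y => b x y + c x y).
Proof.
move=> [b1 b2] [c1 c2]; split => a x y z ? ? ?; first by rewrite b1// c1//; ring.
by rewrite b2// c2//; ring.
Qed.

Lemma bilinear_onN (V W : lmodType R) P Q (b : V -> W -> R) :
  bilinear_on P Q b -> bilinear_on P Q (fun x y => - b x y).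
Proof.
move=> [b1 b2]; split => a x y z ? ? ?; first by rewrite b1//; ring.
by rewrite b2//; ring.
Qed.

Lemma bilinear_on_sum (V W : lmodType R) P Q (I : finType) (b : I -> V -> W -> R) :
  (forall i, bilinear_on P Q (b i)) ->
  bilinear_on P Q (fun x y => \sum_i b i x y).
Proof.
move=> hb; split => a x y z ? ? ?; rewrite mulr_sumr -big_split;
  by apply: eq_bigr => i _; have [b1 b2] := hb i; rewrite (b1, b2).
Qed.

Lemma lincomb_linear (V : lmodType R) n (b : 'I_n -> V) a c d :
  lincomb b (a *: c + d) = a *: lincomb b c + lincomb b d.
Proof.
rewrite /lincomb scaler_sumr -big_split; apply: eq_bigr => j _.
by rewrite !mxE scalerDl scalerA.
Qed.

Lemma lincombB (V : lmodType R) n (b : 'I_n -> V) c d :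
  lincomb b (c - d) = lincomb b c - lincomb b d.
Proof. by have := lincomb_linear b (-1) d c; rewrite !scaleN1r addrC [RHS]addrC. Qed.

Lemma lincomb_closed (V : lmodType R) (P : V -> Prop) n (b : 'I_n -> V) c :
  linear_closed_prop P -> (forall i, P (b i)) -> P (lincomb b c).
Proof.
move=> [P0 PD] Pb; apply: big_rec => // i x _ Px.
exact: PD.
Qed.

Lemma bilinear_lincombr (V W : lmodType R) P Q (b : V -> W -> R) n
    (g : 'I_n -> W) c x :
  bilinear_on P Q b -> linear_closed_prop Q -> P x -> (forall i, Q (g i)) ->
  b x (lincomb g c) = \sum_j c j 0 * b x (g j).
Proof.
move=> [b1 b2] [Q0 QD] Px Qg.
(* Membership of the partial sums in Q is carried along, as linearity applies only there. *)
suff [] : Q (lincomb g c) /\ b x (lincomb g c) = \sum_j c j 0 * b x (g j) by [].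
apply: (big_rec2 (fun (y : W) (r : R) => Q y /\ b x y = r)) => [|i y r _ [Qy <-]].
  split => //; have := b2 (-1) 0 0 x Px Q0 Q0; rewrite scaleN1r addNr mulN1r addNr => ->; exact.
by split; [exact: QD|exact: b2].
Qed.

Lemma bilinear_lincomb (V W : lmodType R) P Q (b : V -> W -> R) m n
    (f : 'I_m -> V) (g : 'I_n -> W) c d :
  bilinear_on P Q b -> linear_closed_prop P -> linear_closed_prop Q ->
  (forall i, P (f i)) -> (forall i, Q (g i)) ->
  b (lincomb f c) (lincomb g d) = dot c (\matrix_(i, j) b (f i) (g j) *m d).
Proof.
move=> bb hP hQ Pf Qg; rewrite (bilinear_lincombr d bb)//; last first.
  exact: lincomb_closed.
have bb' : bilinear_on Q P (fun y x => b x y).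
  by case: bb => b1 b2; split => *; [exact: b2|exact: b1].
under eq_bigr => j _.
  rewrite (bilinear_lincombr c bb' hP (Qg j) Pf) mulr_sumr.
  over.
rewrite exchange_big dotE; apply: eq_bigr => i _; rewrite mxE mulr_sumr.
by apply: eq_bigr => j _; rewrite mxE mulrCA (mulrC (d j 0)).
Qed.

(** This transfers identities from the basis fields, where Sobolev regularity is assumed, to whole
    spans, where only [P] and [Q] have to be propagated. *)
Lemma bilinear_lincomb0 (V W : lmodType R) P Q (b : V -> W -> R) m n
    (f : 'I_m -> V) (g : 'I_n -> W) c d :
  bilinear_on P Q b -> linear_closed_prop P -> linear_closed_prop Q ->
  (forall i, P (f i)) -> (forall i, Q (g i)) ->
  (forall i j, b (f i) (g j) = 0) -> b (lincomb f c) (lincomb g d) = 0.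
Proof.
move=> bb hP hQ Pf Qg b0; rewrite (bilinear_lincomb c d bb)//.
rewrite (_ : \matrix_(_, _) _ = 0) ?mul0mx ?dot0r//.
by apply/matrixP => i j; rewrite !mxE.
Qed.

End bilinear.

(** * The forms of the discrete problem *)

Section forms.
Context (R : realType) (Omega : set (R3 R)).
Local Notation L2 := (L2 Omega).
Local Notation ip := (ip Omega).
Local Notation PW := (L2_wfield Omega).
Local Notation PV := (L2_wvfield Omega).

Lemma L2_wfield_closed : linear_closed_prop PW.
Proof.
by split; [split => [|i]; exact: L20|move=> *; exact: L2_wfield_linear].
Qed.

Lemma L2_wvfield_closed : linear_closed_prop PV.
Proof.
by split; [split => [|j]; exact: L20|move=> *; exact: L2_wvfield_linear].
Qed.

Lemma bilinear_ip (V W : lmodType R) (P : V -> Prop) (Q : W -> Prop)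
    (g : V -> R3 R -> R) (h : W -> R3 R -> R) :
  (forall a x y, g (a *: x + y) = a *: g x + g y) ->
  (forall a x y, h (a *: x + y) = a *: h x + h y) ->
  (forall x, P x -> L2 (g x)) -> (forall x, Q x -> L2 (h x)) ->
  bilinear_on P Q (fun x y => ip (g x) (h y)).
Proof.
move=> gl hl Pg Qh; split => a x y z hx hy hz.
  by rewrite gl ipDl ?ipZl//; do ?[exact: Pg|exact: Qh]; apply: L2Z; exact: Pg.
by rewrite hl ipDr ?ipZr//; do ?[exact: Pg|exact: Qh]; apply: L2Z; exact: Qh.
Qed.

Lemma bilinear_vel :
  bilinear_on PV PV (fun u v => ip_vec Omega (vel u) (vel v)).
Proof.
apply: bilinear_on_sum => i; apply: bilinear_ip => // x hx;
  by have [h _] := hx i; exact: h.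
Qed.

Lemma bilinear_jac :
  bilinear_on PV PV (fun u v => ip_mat Omega (jac u) (jac v)).
Proof.
apply: bilinear_on_sum => i; apply: bilinear_on_sum => j.
by apply: bilinear_ip => // x hx; have [_ h] := hx i; exact: h.
Qed.

Lemma bilinear_div :
  bilinear_on PW PV (fun p v => ip p.1 (div v)).
Proof.
apply: bilinear_ip => //; first exact: div_linear.
  by move=> x [].
by move=> x; exact: L2_div.
Qed.

Lemma bilinear_grad :
  bilinear_on PW PW (fun p q => ip_vec Omega p.2 q.2).
Proof.
apply: bilinear_on_sum => i.
have gradD a (p q : wfield R) : (a *: p + q).2 i = a *: p.2 i + q.2 i.
  exact: erefl.
by apply: (bilinear_ip gradD gradD) => x [_ h]; exact: h.
Qed.

Lemma bilinear_val : bilinear_on PW PW (fun p q => ip p.1 q.1).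
Proof. by apply: bilinear_ip => // x []. Qed.

Lemma bilinear_grad_vel :
  bilinear_on PW PV (fun p v => ip_vec Omega p.2 (vel v)).
Proof.
apply: bilinear_on_sum => i.
have gradD a (p q : wfield R) : (a *: p + q).2 i = a *: p.2 i + q.2 i.
  exact: erefl.
have velD a (u v : wvfield R) : vel (a *: u + v) i = a *: vel u i + vel v i.
  exact: erefl.
apply: (bilinear_ip gradD velD) => [x [_ h]|x hx]; first exact: h.
by have [h _] := hx i; exact: h.
Qed.

Lemma ip_vecC (u v : 'I_3 -> R3 R -> R) : ip_vec Omega u v = ip_vec Omega v u.
Proof. by apply: eq_bigr => i _; exact: ipC. Qed.

Lemma ip_matC A B : ip_mat Omega A B = ip_mat Omega B A.
Proof. by apply: eq_bigr => i _; apply: eq_bigr => j _; exact: ipC. Qed.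

Lemma ip_vec_ge0 u : 0 <= ip_vec Omega u u.
Proof. by apply: sumr_ge0 => i _; exact: ip_ge0. Qed.

Lemma ip_mat_ge0 A : 0 <= ip_mat Omega A A.
Proof. by do 2!apply: sumr_ge0 => ? _; exact: ip_ge0. Qed.

Lemma ip_vec_eq0 u : ip_vec Omega u u = 0 -> forall i, ip (u i) (u i) = 0.
Proof.
move=> /eqP; rewrite psumr_eq0 => [/allP h i|i _]; last exact: ip_ge0.
by apply/eqP; apply: h; rewrite mem_index_enum.
Qed.

Lemma div_integration_by_parts (q : wfield R) (v : wvfield R) :
  H1 Omega q -> (forall i, H10 Omega (v i)) ->
  ip q.1 (div v) = - ip_vec Omega q.2 (vel v).
Proof.
move=> hq hv; have [q2 _] := H1_L2_wfield hq.
have hv2 := H10_L2_wvfield hv.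
rewrite divE ip_sumr//; last by move=> i _; have [_ h] := hv2 i; exact: h.
rewrite -sumrN; apply: eq_bigr => i _.
exact: (H10_integration_by_parts i hq (hv i)).
Qed.

End forms.

Lemma dot_delta (R : realFieldType) n (i : 'I_n) (x : 'cV[R]_n) :
  dot (delta_mx i 0) x = x i 0.
Proof.
rewrite dotE (bigD1 i)//= mxE !eqxx mul1r big1 ?addr0// => j ji.
by rewrite mxE (negbTE ji) mul0r.
Qed.

Lemma lincomb_delta (R : realType) (V : lmodType R) n (b : 'I_n -> V) i :
  lincomb b (delta_mx i 0) = b i.
Proof.
rewrite /lincomb (bigD1 i)//= mxE !eqxx scale1r big1 ?addr0// => j ji.
by rewrite mxE (negbTE ji) scale0r.
Qed.

(** * Matrices of the discrete problem and their inequalities *)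

Section discretization.
Context (R : realType) (Omega : set (R3 R)) (l m : nat).
Context (w : 'I_l -> wvfield R) (q : 'I_m -> wfield R).
Context (k nu : R).
Hypothesis wH : forall i a, H10 Omega (w i a).
Hypothesis qH : forall i, H1 Omega (q i).
Hypothesis w_indep : indep (null_vfield Omega) w.
Hypothesis q_indep : indep (null_field Omega) q.
Hypothesis w_q_inf_sup : inf_sup Omega w q.
Hypotheses (k0 : 0 < k) (nu0 : 0 < nu).

Local Notation ip := (ip Omega).
Local Notation W := (lincomb w).
Local Notation Q := (lincomb q).

Let N : 'M[R]_l := \matrix_(i, j) ip_vec Omega (vel (w i)) (vel (w j)).
Let L : 'M[R]_l := \matrix_(i, j) ip_mat Omega (jac (w i)) (jac (w j)).
Local Notation A := (matA Omega w k nu).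
Local Notation B := (matB Omega w q).
Local Notation G := (matG Omega q).
Local Notation M := (matM Omega q).

Let w2 i : L2_wvfield Omega (w i). Proof. exact: H10_L2_wvfield. Qed.
Let q2 i : L2_wfield Omega (q i). Proof. exact: H1_L2_wfield. Qed.
Let PV := L2_wvfield_closed Omega.
Let PW := L2_wfield_closed Omega.

Lemma dot_N c d : dot c (N *m d) = ip_vec Omega (vel (W c)) (vel (W d)).
Proof. by rewrite (bilinear_lincomb c d (bilinear_vel Omega) PV PV w2 w2). Qed.

Lemma dot_L c d : dot c (L *m d) = ip_mat Omega (jac (W c)) (jac (W d)).
Proof. by rewrite (bilinear_lincomb c d (bilinear_jac Omega) PV PV w2 w2). Qed.

Lemma dot_G c d : dot c (G *m d) = ip_vec Omega (Q c).2 (Q d).2.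
Proof. by rewrite (bilinear_lincomb c d (bilinear_grad Omega) PW PW q2 q2). Qed.

Lemma dot_M c d : dot c (M *m d) = ip (Q c).1 (Q d).1.
Proof. by rewrite (bilinear_lincomb c d (bilinear_val Omega) PW PW q2 q2). Qed.

Lemma dot_B c d : dot c (B *m d) = - ip (Q c).1 (div (W d)).
Proof.
rewrite (bilinear_lincomb c d (bilinear_div Omega) PW PV q2 w2) -dotNr -mulNmx.
by congr (dot _ (_ *m _)); apply/matrixP => i j; rewrite !mxE.
Qed.

(** Integration by parts, checked on the basis fields. This form of B is compared with G, the
    divergence form with M. *)
Lemma dot_B_grad c d : dot c (B *m d) = ip_vec Omega (Q c).2 (vel (W d)).
Proof.
rewrite dot_B; apply/eqP; rewrite eqr_oppLR -subr_eq0 opprK; apply/eqP.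
apply: (bilinear_lincomb0 c d
  (bilinear_onD (bilinear_div Omega) (bilinear_grad_vel Omega)) PW PV q2 w2).
by move=> i j; rewrite div_integration_by_parts// addNr.
Qed.

Lemma matAE : A = 3 / 2 *: N + (k * nu) *: L.
Proof. by apply/matrixP => i j; rewrite !mxE. Qed.

Lemma matA_row c i : (A *m c) i 0 =
  3 / 2 * ip_vec Omega (vel (W c)) (vel (w i))
  + k * nu * ip_mat Omega (jac (W c)) (jac (w i)).
Proof.
rewrite -dot_delta matAE mulmxDl -!scalemxAl dotDr !dotZr dot_N dot_L.
by rewrite lincomb_delta ip_vecC ip_matC.
Qed.

Lemma matG_row c i : (G *m c) i 0 = ip_vec Omega (Q c).2 (q i).2.
Proof. by rewrite -dot_delta dot_G lincomb_delta ip_vecC. Qed.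

Lemma matM_row c i : (M *m c) i 0 = ip (Q c).1 (q i).1.
Proof. by rewrite -dot_delta dot_M lincomb_delta ipC. Qed.

Lemma matB_row c i : (B *m c) i 0 = - ip (div (W c)) (q i).1.
Proof. by rewrite -dot_delta dot_B lincomb_delta ipC. Qed.

Lemma matB_trmx_row x i : (B^T *m x) i 0 = - ip (div (w i)) (Q x).1.
Proof.
by rewrite -dot_delta dot_mulmx trmxK dotC dot_B lincomb_delta ipC.
Qed.

Lemma ip_div_le_span c :
  ip (div (W c)) (div (W c)) <= ip_mat Omega (jac (W c)) (jac (W c)).
Proof.
have Wc : L2_wvfield Omega (W c) by exact: lincomb_closed PV w2.
apply: ip_div_le_ip_mat => // i j.
apply/eqP; rewrite -subr_eq0; apply/eqP.
(* The exchange of derivatives is stated as the vanishing of a bilinear form, so that it passes from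
   the basis fields to the span. *)
pose b (u v : wvfield R) :=
  ip ((u i).2 i) ((v j).2 j) + - ip ((u i).2 j) ((v j).2 i).
have bb : bilinear_on (L2_wvfield Omega) (L2_wvfield Omega) b.
  by apply: bilinear_onD; [|apply: bilinear_onN]; apply: bilinear_ip => // x hx;
    (have [_ h] := hx i); (have [_ h'] := hx j); (exact: h || exact: h').
apply: (bilinear_lincomb0 c c bb PV PV w2 w2) => i' j'.
by rewrite /b (H10_partial_swap i j (wH i' i) (wH j' j)) subrr.
Qed.

Lemma matA_sym : A^T = A.
Proof.
by apply/matrixP => i j; rewrite !mxE ip_vecC ip_matC.
Qed.

(** Strictness comes from the mass term: if it vanishes, the velocity is null almost everywhere and
    independence applies. *)
Lemma matA_posdef : posdef A.
Proof.
split; first exact: matA_sym.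
move=> c c0; rewrite matAE mulmxDl -!scalemxAl dotDr !dotZr dot_N dot_L.
rewrite ltr_pwDl ?mulr_ge0 ?ip_mat_ge0 ?(ltW k0) ?(ltW nu0)//.
rewrite mulr_gt0 ?divr_gt0// lt_neqAle ip_vec_ge0 andbT.
apply/eqP => /esym/ip_vec_eq0 W0; move/eqP: c0; apply; apply: w_indep => i.
have Wc : L2_wvfield Omega (W c) by exact: lincomb_closed PV w2.
by apply: ip_eq0; [have [] := Wc i|exact: W0].
Qed.

Lemma matM_posdef : posdef M.
Proof.
split; first by apply/matrixP => i j; rewrite !mxE ipC.
move=> c c0; rewrite dot_M lt_neqAle ip_ge0 andbT.
apply/eqP => /esym Q0; move/eqP: c0; apply; apply: q_indep.
have Qc : L2_wfield Omega (Q c) by exact: lincomb_closed PW q2.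
by apply: ip_eq0; [have [] := Qc|exact: Q0].
Qed.

(** Otherwise the field with coefficients x is not null and is orthogonal to all divergences, so its
    supremum in the inf-sup condition is at most 0. *)
Lemma matB_trmx_inj (x : 'cV[R]_m) : B^T *m x = 0 -> x = 0.
Proof.
move=> Bx; apply: q_indep; apply: contrapT => Qx.
have := w_q_inf_sup; rewrite /inf_sup ltNge => /negP; apply.
apply: (le_trans (ereal_inf_lbound _)).
  by exists (Q x) => //; split => //; exists x.
apply: ge_ereal_sup => _ [_ [[c _ <-] _] <-].
have := dot_B x c; rewrite dot_mulmx Bx dotC dot0r ipC.
by move=> /esym/eqP; rewrite oppr_eq0 => /eqP ->; rewrite mul0r.
Qed.

(* A field of [Q] with vanishing gradient is orthogonal to all divergences,
   so the inf-sup condition replaces connectedness of the domain here. *)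
Lemma matG_posdef : posdef G.
Proof.
split; first by apply/matrixP => i j; rewrite !mxE ip_vecC.
move=> c c0; rewrite dot_G lt_neqAle ip_vec_ge0 andbT.
apply/eqP => /esym/ip_vec_eq0 Q0; move/eqP: c0; apply.
(* |B^T c|^2 = c.B(B^T c) pairs the vanishing gradient with the velocity of coefficients B^T c. *)
apply: matB_trmx_inj; apply: dotxx_eq0; rewrite -dot_mulmx dot_B_grad.
apply: big1 => i _; set d := B^T *m c.
have [_ Qc] : L2_wfield Omega (Q c) by exact: lincomb_closed PW q2.
have Wd : L2_wvfield Omega (W d) by exact: lincomb_closed PV w2.
apply/eqP; rewrite -normr_le0.
apply: (le_trans (@ip_CauchySchwarz _ Omega _ _ (Qc i) _)).
  by have [] := Wd i.
by rewrite /L2norm Q0 sqrtr0 mul0r.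
Qed.

(** Young's inequality for (grad q, v). Optimising over x recovers the bound on the L2 projection of
    v onto the discrete gradients. *)
Lemma matB_grad_le x y :
  2 * dot x (B *m y) <= dot x (G *m x) + dot y (N *m y).
Proof.
rewrite dot_B_grad dot_G dot_N /ip_vec mulr_sumr -big_split.
apply: ler_sum => i _; apply: ip_young.
  by have [_ h] : L2_wfield Omega (Q x); [exact: lincomb_closed PW q2|exact: h].
by have [] : L2_wfield Omega (W y i) by exact: (lincomb_closed _ PV w2).
Qed.

Lemma matB_val_le x y :
  2 * dot x (B *m y) <= dot x (M *m x) + dot y (L *m y).
Proof.
have [Qx _] : L2_wfield Omega (Q x) by exact: lincomb_closed PW q2.
have Wy : L2 Omega (div (W y)) by apply: L2_div; exact: lincomb_closed PV w2.
rewrite dot_B dot_M dot_L -ipNr//.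
have Wy' := L2N Wy.
rewrite (le_trans (ip_young Qx Wy'))// lerD2l.
by rewrite ipNr// ipC ipNr// opprK ip_div_le_span.
Qed.

End discretization.

(** * Error recursion and passage from coefficients to norms *)

Lemma uzawa_step (R : fieldType) l m (A : 'M[R]_l) (B : 'M[R]_(m, l))
    (G M : 'M[R]_m) (k alpha rho : R) (x x' phi : 'cV[R]_m) (e : 'cV[R]_l) :
  A \in unitmx -> G \in unitmx -> M \in unitmx -> k != 0 ->
  A *m e = - k *: (B^T *m x) -> G *m phi = k^-1 *: (B *m e) ->
  M *m x' = M *m x + alpha *: (M *m phi) + rho *: (B *m e) ->
  x' = (1%:M - (alpha *: invmx G + (rho * k) *: invmx M)
               *m B *m invmx A *m B^T) *m x.
Proof.
move=> Au Gu Mu k0 eE phiE x'E.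
(* Then B e = -k t and phi = -G^-1 t: the factor k cancels in the potential but remains in the
   direct term, whence the weight rho k. *)
pose t := B *m invmx A *m B^T *m x.
have Be : B *m e = - k *: t.
  by rewrite -(mulKmx Au e) eE -scalemxAr -scalemxAr /t !mulmxA.
have {}phiE : phi = - (invmx G *m t).
  rewrite -(mulKmx Gu phi) phiE Be scalerA mulrN mulVf// scaleN1r.
  by rewrite mulmxN.
have {}x'E : x' = x + alpha *: phi + rho *: (invmx M *m (B *m e)).
  by rewrite -(mulKmx Mu x') x'E !mulmxDr -!scalemxAr !mulKmx.
rewrite mulmxBl mul1mx -!mulmxA mulmxDl -!scalemxAl x'E phiE Be.
have -> : B *m (invmx A *m (B^T *m x)) = t by rewrite /t !mulmxA.
by rewrite -scalemxAr scalerA mulrN scaleNr scalerN opprD addrA.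
Qed.

Lemma norm_on_lincomb_le (R : realType) (V : lmodType R) n (b : 'I_n -> V)
    (N : V -> R) (c : 'cV[R]_n) (C : R) :
  is_norm_on (lin_span b) N -> (forall i, `|c i 0| <= C) ->
  N (lincomb b c) <= C * \sum_i N (b i).
Proof.
move=> [N0 _ ND NZ] cC.
have Sb i : lin_span b (b i) by exists (delta_mx i 0) => //; exact: lincomb_delta.
have S0 : lin_span b 0.
  by exists 0 => //; apply: big1 => i _; rewrite mxE scale0r.
have N00 : N 0 = 0 by rewrite -(scale0r 0) NZ// normr0 mul0r.
(* The norm axioms hold on the span only, so the partial sums are kept in it. *)
suff [] : lin_span b (lincomb b c) /\ N (lincomb b c) <= C * \sum_i N (b i) by [].
rewrite mulr_sumr /lincomb.
apply: (big_ind2 (fun y r => lin_span b y /\ N y <= r)).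
- by rewrite N00.
- move=> y1 r1 y2 r2 [[c1 _ <-] h1] [[c2 _ <-] h2]; split.
    by exists (1 *: c1 + c2) => //; rewrite lincomb_linear scale1r.
  by rewrite (le_trans (ND _ _ _ _)) ?lerD//; eexists.
- move=> i _; split.
    exists (c i 0 *: delta_mx i 0 + 0) => //.
    rewrite lincomb_linear lincomb_delta [X in _ + X]big1 ?addr0//.
    by move=> j _; rewrite mxE scale0r.
  by rewrite NZ// ler_wpM2r// N0.
Qed.

Lemma mulmx_col_le (R : realDomainType) m n (P : 'M[R]_(m, n)) (x : 'cV[R]_n)
    (C : R) i : 0 <= C -> (forall j, `|x j 0| <= C) ->
  `|(P *m x) i 0| <= (\sum_i \sum_j `|P i j|) * C.
Proof.
move=> C0 xC; rewrite mxE (le_trans (ler_norm_sum _ _ _))//.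
apply: (@le_trans _ _ ((\sum_j `|P i j|) * C)).
  by rewrite mulr_suml; apply: ler_sum => j _; rewrite normrM ler_wpM2l.
rewrite ler_wpM2r// (bigD1 i)//= lerDl.
by do 2!apply: sumr_ge0 => ? _.
Qed.

Unset Implicit Arguments.
Set Strict Implicit.
Set Printing Implicit Defensive.

Theorem theorem1 (R : realType) (Omega : set (R3 R))
  (l m : nat) (w : 'I_l -> wvfield R) (q : 'I_m -> wfield R)
  (F : 'I_3 -> R3 R -> R) (k nu alpha rho : R)
  (us : nat -> wvfield R) (phis ps : nat -> wfield R)
  (u : wvfield R) (p : wfield R) (pbar : nat -> 'cV[R]_m) :
  bounded_domain Omega ->
  (forall i a, H10 Omega (w i a)) ->
  (forall i, H1 Omega (q i) /\ mean_zero Omega (q i)) ->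
  indep (null_vfield Omega) w ->
  indep (null_field Omega) q ->
  inf_sup Omega w q ->
  (forall a, L2 Omega (F a)) ->
  0 < nu -> 0 < k -> 0 <= alpha -> 0 <= rho -> (alpha, rho) <> (0, 0) ->
  (forall s, [/\ lin_span w (us s), lin_span q (phis s) & lin_span q (ps s)]) ->
  (forall s i,
    3 / 2 * ip_vec Omega (vel (us s)) (vel (w i))
    + k * nu * ip_mat Omega (jac (us s)) (jac (w i))
    - k * ip Omega (div (w i)) (ps s).1 = ip_vec Omega F (vel (w i))) ->
  (forall s i,
    ip_vec Omega (phis s).2 (q i).2
    = - (1 / k) * ip Omega (div (us s)) (q i).1) ->
  (forall s i,
    ip Omega (ps s.+1).1 (q i).1
    = ip Omega (ps s).1 (q i).1 + alpha * ip Omega (phis s).1 (q i).1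
      - rho * ip Omega (div (us s)) (q i).1) ->
  lin_span w u -> lin_span q p ->
  (forall i,
    3 / 2 * ip_vec Omega (vel u) (vel (w i))
    + k * nu * ip_mat Omega (jac u) (jac (w i))
    - k * ip Omega (div (w i)) p.1 = ip_vec Omega F (vel (w i))) ->
  (forall i, ip Omega (div u) (q i).1 = 0) ->
  (forall s, ps s - p = lincomb q (pbar s)) ->
  (forall xi : m.-tuple 'cV[R]_m,
    is_eigenbasis (matK Omega w q k nu alpha rho) xi ->
    forall s, norm_inf_basis xi (pbar s.+1)
      <= spr (1%:M - matK Omega w q k nu alpha rho)
         * norm_inf_basis xi (pbar s)) /\
  (Num.max (alpha / (3 / 2)) (rho / nu) < 2 ->
    forall (NV : wvfield R -> R) (NQ : wfield R -> R),
      is_norm_on (lin_span w) NV -> is_norm_on (lin_span q) NQ ->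
      exists c gamma : R, [/\ 0 <= c, 0 < gamma, gamma < 1 &
        forall s, NV (us s - u) <= c * gamma ^+ s /\
                  NQ (ps s - p) <= c * gamma ^+ s]).
Proof.
move=> _ wH qHm w_indep q_indep infsup _ nu0 k0 alpha0 rho0 ar0 spans.
move=> us_eq phis_eq ps_eq u_span p_span u_eq div_u pbarE.
have qH i : H1 Omega (q i) by have [] := qHm i.
have q2 i : L2_wfield Omega (q i) by exact: H1_L2_wfield.
have w2 i : L2_wvfield Omega (w i) by exact: H10_L2_wvfield.
have [p2 _] : L2_wfield Omega p.
  by case: p_span => c _ <-; exact: lincomb_closed (L2_wfield_closed _) q2.
have ps2 s : L2 Omega (ps s).1.
  have [_ _ [c _ <-]] := spans s.
  by have [] := lincomb_closed c (L2_wfield_closed Omega) q2.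
have /choice[U usE] : forall s, exists c, us s = lincomb w c.
  move=> s.
  by have [[c _ <-] _ _] := spans s; exists c.
have /choice[Phi phisE] : forall s, exists c, phis s = lincomb q c.
  move=> s.
  by have [_ [c _ <-] _] := spans s; exists c.
have [U' _ uE] := u_span.
pose e s := U s - U'.
have eE s : us s - u = lincomb w (e s) by rewrite lincombB -usE uE.
set A := matA Omega w k nu.
pose B := matB Omega w q; pose G := matG Omega q; pose M := matM Omega q.
have Apd : posdef A by exact: matA_posdef.
have Gpd : posdef G by exact: matG_posdef.
have Mpd : posdef M by exact: matM_posdef.
(* Subtracting the two momentum equations eliminates F. *)
have momentum s : A *m e s = - k *: (B^T *m pbar s).
  apply/colP => i; rewrite mulmxBr [LHS]mxE [X in _ + X]mxE [RHS]mxE.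
  rewrite !matA_row// matB_trmx_row// -usE uE -pbarE ipBr//; last first.
    by apply: L2_div.
  by have := us_eq s i; have := u_eq i; lra.
(* By discrete incompressibility of u, B sees only the error of the velocity; the potential [Phi s]
   is then itself an error term. *)
have BU' : B *m U' = 0.
  by apply/colP => i; rewrite matB_row// uE div_u mxE oppr0.
have potential s : G *m Phi s = k^-1 *: (B *m e s).
  apply/colP => i; rewrite mulmxBr BU' subr0 [RHS]mxE matG_row// matB_row//.
  by rewrite -usE -phisE phis_eq div1r mulrN mulNr.
have pressure s : M *m pbar s.+1
    = M *m pbar s + alpha *: (M *m Phi s) + rho *: (B *m e s).
  apply/colP => i; rewrite mulmxBr BU' subr0 [RHS]mxE [X in X + _]mxE.
  rewrite [X in _ + X + _]mxE [X in _ = _ + X]mxE !matM_row// matB_row//.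
  rewrite -usE -phisE -!pbarE.
  rewrite (ipC _ (ps s.+1 - p).1) (ipC _ (ps s - p).1) !ipBr//;
    do ?by have [] := q2 i.
  rewrite !(ipC _ (q i).1) ps_eq; lra.
have step s : pbar s.+1 = (1%:M - matK Omega w q k nu alpha rho) *m pbar s.
  apply: uzawa_step (momentum s) (potential s) (pressure s);
    by rewrite ?posdef_unit ?gt_eqF.
split=> [xi xiK s|theta2 NV NQ NVn NQn].
  by rewrite step; exact: norm_inf_basis_contraction.
pose S := alpha *: invmx G + (rho * k) *: invmx M.
pose T := B *m invmx A *m B^T.
have KE : matK Omega w q k nu alpha rho = S *m T by rewrite /T !mulmxA.
pose N := \matrix_(i, j) ip_vec Omega (vel (w i)) (vel (w j)).
have N_ge0 c : 0 <= dot c (N *m c) by rewrite dot_N// ip_vec_ge0.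
pose L := \matrix_(i, j) ip_mat Omega (jac (w i)) (jac (w j)).
have L_ge0 c : 0 <= dot c (L *m c) by rewrite dot_L// ip_mat_ge0.
have [g [g0 g1 gE]] := @uzawa_energy_contraction R l m A _ _ G M B (3 / 2) k nu
  alpha rho Apd Gpd Mpd (matAE Omega w k nu) (matB_trmx_inj wH qH q_indep infsup)
  N_ge0 L_ge0 (matB_grad_le wH qH) (matB_val_le wH qH) (divr_gt0 (ltr0n R 3) (ltr0n R 2))
  k0 nu0 alpha0 rho0 ar0 theta2.
have Spd : posdef S by exact: precond_posdef.
have g01 : 0 < g < 1 by rewrite g0.
have [c c0 pbar_le] := geometric_decay (posdef_inv Spd) g01 gE
  (fun s => eq_ind _ (fun K => pbar s.+1 = (1%:M - K) *m pbar s) (step s) _ KE).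
have gs0 : 0 < Num.sqrt g by rewrite sqrtr_gt0.
have gs1 : Num.sqrt g < 1 by rewrite -sqrtr1 ltr_sqrt.
(* The velocity error is a fixed linear image of the pressure error at the same step, hence decays
   at the same rate. *)
pose P := - k *: (invmx A *m B^T).
have eP s : e s = P *m pbar s.
  rewrite -(mulKmx (posdef_unit Apd) (e s)) momentum /P -scalemxAr -scalemxAl.
  by rewrite mulmxA.
pose CP := \sum_i \sum_j `|P i j|.
have CP0 : 0 <= CP by do 2!apply: sumr_ge0 => ? _.
have NV0 : 0 <= \sum_i NV (w i).
  apply: sumr_ge0 => i _; have [h _ _ _] := NVn; apply: h.
  by exists (delta_mx i 0) => //; exact: lincomb_delta.
have NQ0 : 0 <= \sum_i NQ (q i).
  apply: sumr_ge0 => i _; have [h _ _ _] := NQn; apply: h.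
  by exists (delta_mx i 0) => //; exact: lincomb_delta.
(* The first summand bounds the velocity error and the second the pressure error. *)
exists (CP * c * \sum_i NV (w i) + c * \sum_i NQ (q i)), (Num.sqrt g).
split => //; first by rewrite addr_ge0 ?mulr_ge0.
move=> s; have gS : 0 <= Num.sqrt g ^+ s by rewrite exprn_ge0// ltW.
have cg0 : 0 <= c * Num.sqrt g ^+ s by rewrite mulr_ge0.
have hQ := norm_on_lincomb_le NQn (pbar_le s).
have he i : `|e s i 0| <= CP * (c * Num.sqrt g ^+ s).
  by rewrite eP mulmx_col_le.
have hV := norm_on_lincomb_le NVn he.
rewrite eE pbarE; split.
  rewrite (le_trans hV)// mulrDl (mulrAC _ (\sum_i NV _)) !mulrA lerDl.
  by rewrite !mulr_ge0.
rewrite (le_trans hQ)// mulrDl (mulrAC c) lerDr.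
by rewrite !mulr_ge0.
Qed.
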